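(* Let $n$ and $k$ be integers with $1 \le k \le n-1$, and let $x_1, \dots, x_n$ be real numbers. Suppose that for every subset $U \subseteq \{1,\dots,n\}$ with $|U| > k$ we have $\sum_{i \in U} x_i < 0$. Then the number of subsets $U \subseteq \{1,\dots,n\}$ (including the empty set) with $\sum_{i\in U} x_i \ge 0$ is at most $$\binom{n-1}{k-1} + \binom{n-1}{k-2} + \cdots + \binom{n-1}{0} + 1.$$
   Context: Subsets of the sequence are identified with subsets of the index set $\{1,\dots,n\}$; the empty set has sum $0$ and so counts as a subset with nonnegative sum. *)

(* Defs.v *)
From mathcomp Require Export all_boot all_order all_algebra.
From mathcomp Require Export reals.

Set Implicit Arguments.
Unset Strict Implicit.
Unset Printing Implicit Defensive.

(* Main.v *)
(** The bound is proved for a general offset [s <= 0], counting the nonempty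
    [U] in [D] with [s + sum_U x >= 0], by induction on [|D|] following Pascal's
    rule. As [s + sum_D x < 0], some [i] in [D] has [s + x i < 0]. The counted
    sets avoiding [i] live in [D :\ i] with the same [k] and [s]; those
    containing [i] live there with [k - 1] and [s + x i], and [{i}] is not
    among them. The recursion stops at [k = 0], and at [k = |D| - 1], where a
    set and its complement are never both counted because
    [2 s + sum_D x < 0]. *)

Require Import Defs.
From mathcomp Require Import all_boot all_order all_algebra.
From mathcomp Require Import reals.

Import Order.TTheory GRing.Theory Num.Theory.
Local Open Scope ring_scope.

Lemma sum_binS (m k : nat) :
  (\sum_(0 <= j < k.+1) 'C(m.+1, j) =
   \sum_(0 <= j < k.+1) 'C(m, j) + \sum_(0 <= j < k) 'C(m, j))%N.
Proof.
rewrite big_nat_recl // [in RHS]big_nat_recl // !bin0 -addnA -big_split /=.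
by congr (_ + _)%N; apply: eq_bigr => j _; rewrite binS.
Qed.

(** Row [m] of Pascal's triangle sums to [2 ^ m]; the successor supplies the missing last entry
    ['C(m, m) = 1]. *)
Lemma sum_bin_lt (m : nat) : ((\sum_(0 <= j < m) 'C(m, j)).+1 = 2 ^ m)%N.
Proof.
rewrite -addn1 -[X in (_ + X)%N](binn m) -(big_nat_recr m 0 (fun j => 'C(m, j))) //.
rewrite big_mkord -[(2 ^ m)%N]/((1 + 1) ^ m)%N expnDn.
by apply: eq_bigr => i _; rewrite !exp1n !muln1.
Qed.

Section NonnegativeSubsets.
Variables (R : realDomainType) (T : finType) (x : T -> R).
Implicit Types (D U : {set T}) (s : R).

(** The empty set is excluded because at [s = 0] it would break the bound [0] for [k = 0]. *)
Definition nonneg_subsets D s : {set {set T}} :=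
  [set U : {set T} | [&& U \subset D, U != set0 & 0 <= s + \sum_(i in U) x i]].

(** Otherwise each [x i] with [i] in [D] is at least [- s >= 0]; one term then absorbs [s] and the
    others only increase the sum. *)
Lemma exists_offset_neg D s :
  D != set0 -> s <= 0 -> s + \sum_(i in D) x i < 0 ->
  exists2 i, i \in D & s + x i < 0.
Proof.
case/set0Pn => i0 Di0 s0 sD.
have [/existsP[i /andP[Di si]]|/existsPn all_ge] :=
  boolP [exists i, (i \in D) && (s + x i < 0)]; first by exists i.
have ge i : i \in D -> 0 <= s + x i.
  by move=> Di; have := all_ge i; rewrite Di /= leNgt.
suff: 0 <= s + \sum_(i in D) x i by rewrite leNgt sD.
rewrite (bigD1 i0) //= addrA addr_ge0 ?ge // sumr_ge0 // => i /andP[Di _].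
by apply: le_trans (ge i Di) _; rewrite gerDr.
Qed.

Lemma card_nonneg_subsets_complement D s :
  D != set0 -> s <= 0 -> s + \sum_(i in D) x i < 0 ->
  (2 * #|nonneg_subsets D s|.+1 <= 2 ^ #|D|)%N.
Proof.
move=> D0 s0 sD; set F := nonneg_subsets D s.
(* Adjoining the empty set is harmless, as its complement [D] is not counted; this gives the
   successor in the bound. *)
pose F0 := set0 |: F; pose G := [set D :\: U | U in F0].
have F0D U : U \in F0 -> U \subset D.
  by rewrite !inE => /orP[/eqP->|/andP[]//]; rewrite sub0set.
have DDK U : U \in F0 -> D :\: (D :\: U) = U.
  by move=> /F0D UD; rewrite setDDr setDv set0U; apply/setIidPr.
have notF0 U : U \in F0 -> D :\: U \notin F0.
  move=> F0U; apply/negP; rewrite !inE => /orP[/eqP DU0|/and3P[_ _ sDU]].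
    have UD : U = D by rewrite -(DDK U F0U) DU0 setD0.
    by move: F0U; rewrite UD !inE (negPf D0) subxx /= leNgt sD.
  move: F0U sDU; rewrite !inE => /orP[/eqP->|/and3P[UD _ sU] sDU].
    by rewrite setD0 leNgt sD.
  (* Adding the inequalities for [U] and [D :\: U] would make this quantity nonnegative. *)
  suff: s + (s + \sum_(i in D) x i) < 0.
    rewrite (big_setID U) /= (setIidPr UD) ltNge => /negP; apply.
    by rewrite (addrA s (\sum_(i in U) x i)) addrCA addr_ge0.
  by rewrite -[ltRHS]addr0 ler_ltD.
have cardF0 : #|F0| = #|F|.+1 by rewrite cardsU1 !inE eqxx andbF.
have cardG : #|G| = #|F|.+1.
  by rewrite card_in_imset // => U V /DDK {2}<- /DDK {2}<- ->.
have FG0 : F0 :&: G = set0.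
  apply/setP => U; rewrite [RHS]inE; apply/negP => /setIP[F0U /imsetP[V F0V UE]].
  by have := notF0 V F0V; rewrite -UE F0U.
rewrite mul2n -addnn -{1}cardF0 -cardG -cardsUI FG0 cards0 addn0 -card_powerset.
apply/subset_leq_card/subsetP => U /setUP[/F0D|/imsetP[V _ ->]].
  by rewrite powersetE.
by rewrite powersetE subsetDl.
Qed.

Lemma card_nonneg_subsets_split D s i :
  i \in D -> s + x i < 0 ->
  (#|nonneg_subsets D s| <=
   #|nonneg_subsets (D :\ i) s| + #|nonneg_subsets (D :\ i) (s + x i)|)%N.
Proof.
move=> Di si; set F := nonneg_subsets D s.
rewrite -(cardsID [set U : {set T} | i \in U] F) addnC leq_add //.
  apply/subset_leq_card/subsetP => U; rewrite !inE => /andP[iU /and3P[UD U0 sU]].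
  by rewrite subsetD1 UD iU U0.
rewrite -(@card_in_imset _ _ (fun U : {set T} => U :\ i)); last first.
  move=> U V; rewrite !inE => /andP[_ iU] /andP[_ iV] eqUV.
  by rewrite -(setD1K iU) eqUV setD1K.
apply/subset_leq_card/subsetP => _ /imsetP[U + ->].
rewrite !inE => /andP[/and3P[UD U0 sU] iU].
have sUi : 0 <= s + x i + \sum_(j in U :\ i) x j by rewrite -addrA -big_setD1.
rewrite setSD // sUi andbT; apply: contraTneq sUi => ->.
by rewrite big_set0 addr0 -ltNge.
Qed.

Lemma card_nonneg_subsets D s k :
  (k < #|D|)%N -> s <= 0 ->
  (forall U, U \subset D -> (k < #|U|)%N -> s + \sum_(i in U) x i < 0) ->
  (#|nonneg_subsets D s| <= \sum_(0 <= j < k) 'C(#|D|.-1, j))%N.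
Proof.
move cardD: #|D| => n; elim: n D s k cardD => // m IHm D s k cardD kD s0 neg /=.
have D0 : D != set0 by rewrite -card_gt0 cardD.
have sD : s + \sum_(i in D) x i < 0 by apply: neg; rewrite ?cardD.
have [k_eq0|k_gt0] := posnP k.
  rewrite k_eq0 big_geq // leqn0 cards_eq0 -subset0; apply/subsetP => U.
  rewrite !inE => /and3P[UD U0].
  by rewrite leNgt neg // k_eq0 card_gt0.
have [km|mk] := ltnP k m; last first.
  have -> : k = m by apply/eqP; rewrite eqn_leq -ltnS kD mk.
  rewrite -ltnS sum_bin_lt -(leq_pmul2l (isT : 0 < 2)%N) -expnS -cardD.
  exact: card_nonneg_subsets_complement.
have [i Di si] := exists_offset_neg _ _ D0 s0 sD.
have cardDi : #|D :\ i| = m by apply/eqP; rewrite -eqSS -cardD (cardsD1 i D) Di.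
apply: leq_trans (card_nonneg_subsets_split _ _ _ Di si) _.
case: k k_gt0 km neg {kD} => // k _ km neg.
(* Pascal's rule needs [m] to be a successor, which [km] guarantees. *)
case: m IHm cardD km cardDi => // m IHm _ km cardDi.
rewrite sum_binS leq_add //.
  apply: (IHm _ _ k.+1) => // U /subset_trans UD; apply: neg.
  by apply: UD; rewrite subD1set.
apply: (IHm _ _ k) => //; [exact: ltnW | exact: ltW | move=> U].
rewrite subsetD1 => /andP[UD iU] kU.
(* Putting [i] back absorbs [x i] from the offset and raises the size above [k.+1]. *)
rewrite -addrA -big_setU1 //; apply: neg; first by rewrite subUset sub1set Di.
by rewrite cardsU1 iU.
Qed.

End NonnegativeSubsets.

Theorem theorem1p1 (R : realType) (n k : nat)
    (hk1 : (1 <= k)%N) (hkn : (k <= n - 1)%N) (x : 'I_n -> R)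
    (hneg : forall U : {set 'I_n}, (k < #|U|)%N -> \sum_(i in U) x i < 0) :
  (#|[set U : {set 'I_n} | (0 <= \sum_(i in U) x i)%R]|
     <= \sum_(0 <= j < k) 'C(n - 1, j) + 1)%N.
Proof.
have kn : (k < #|[set: 'I_n]|)%N.
  (* Subtraction is truncated: [n = 0] would give [k <= 0], against [hk1]. *)
  by rewrite cardsT card_ord; case: n hkn {x hneg} => [|m]; rewrite ?subn1 // leqNgt hk1.
have neg (U : {set 'I_n}) : U \subset setT -> (k < #|U|)%N ->
    0 + \sum_(i in U) x i < 0.
  by move=> _ kU; rewrite add0r hneg.
have := card_nonneg_subsets _ _ x _ _ _ kn (lexx 0) neg.
rewrite cardsT card_ord -subn1 -(leq_add2r 1); apply: leq_trans.
(* The empty set accounts for the final [+ 1]. *)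
rewrite (cardsD1 set0) addnC leq_add ?leq_b1 //.
by apply/subset_leq_card/subsetP => U; rewrite !inE subsetT add0r.
Qed.
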